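(* Let $A,B,C$ be any strings, and let $|A|=M$, $|B|=N$, $|\mathit{RLE}(A)|=m$ and $|\mathit{RLE}(B)|=n$. If $|\mathit{RLE}(C)|=1$, the length of an STR-IC-LCS of $A,B,C$ can be computed in $O(mN+nM)$ time.
   Context: Strings are over a finite alphabet $\Sigma$. A string $Z$ is a subsequence of $A$ if $Z$ can be obtained from $A$ by deleting zero or more characters. An STR-IC-LCS of $A,B,C$ is a longest string $Z$ that contains $C$ as a substring (contiguous) and is a subsequence of both $A$ and $B$; the task is to compute its length given $A,B,C$. The run-length encoding $\mathit{RLE}(A)$ represents each maximal run of equal characters by the pair (character, run length); $|\mathit{RLE}(A)|$ is the number of maximal runs of $A$. Standing assumptions of the paper: $0<|C|\le\min\{M,N\}$. *)

(* Defs.v *)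
From mathcomp Require Import all_boot.

Set Implicit Arguments.
Unset Strict Implicit.
Unset Printing Implicit Defensive.

(** * Strings *)

Fixpoint rle (T : eqType) (s : seq T) : seq (T * nat) :=
  match s with
  | [::] => [::]
  | x :: s' =>
      match rle s' with
      | [::] => [:: (x, 1)]
      | (y, l) :: r => if x == y then (y, l.+1) :: r else (x, 1) :: (y, l) :: r
      end
  end.

Definition str_ic_cs (T : eqType) (A B C Z : seq T) : bool :=
  [&& infix C Z, subseq Z A & subseq Z B].

Definition str_ic_lcs (T : eqType) (A B C Z : seq T) : Prop :=
  str_ic_cs A B C Z /\ forall Z', str_ic_cs A B C Z' -> size Z' <= size Z.

(* An STR-IC-LCS need not exist; it then has to be reported by the answer 0,
   which is unambiguous when C is nonempty. *)
Definition str_ic_lcs_length (T : eqType) (A B C : seq T) (l : nat) : Prop :=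
  (exists Z, str_ic_lcs A B C Z /\ size Z = l) \/
  ((forall Z, ~~ str_ic_cs A B C Z) /\ l = 0).

(** * Word RAM

    Programs are structured, with registers and memory segments named by
    numerals: a program mentions finitely many of them, so segments can be
    interleaved in one flat memory and the control flow compiled to jumps with
    constant overhead per step.  Words have [w] bits.  Execution has no rule for
    an operation whose result does not fit in a word, so a run that overflows
    does not count as a run at all. *)

Inductive binop := Add | Sub | Mul | Eq | Leq.

Inductive expr :=
| Const of nat
| Reg of nat
| Read of nat & expr                (* segment, address *)
| Bin of binop & expr & expr.

Inductive cmd :=
| Skip
| Assign of nat & expr              (* register, value *)
| Write of nat & expr & expr        (* segment, address, value *)
| Seq of cmd & cmd
| If of expr & cmd & cmd
| While of expr & cmd.

Record state := State { regs : nat -> nat; mem : nat -> nat -> nat }.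

Definition upd (T : Type) (f : nat -> T) (x : nat) (v : T) : nat -> T :=
  fun y => if y == x then v else f y.

Definition set_reg (s : state) (x v : nat) : state :=
  State (upd (regs s) x v) (mem s).

Definition set_mem (s : state) (a i v : nat) : state :=
  State (regs s) (upd (mem s) a (upd (mem s a) i v)).

(* Subtraction is truncated; comparisons return 0 or 1. *)
Definition binop_val (o : binop) (u v : nat) : nat :=
  match o with
  | Add => u + v
  | Sub => u - v
  | Mul => u * v
  | Eq => u == v
  | Leq => u <= v
  end.

Definition word (w v : nat) : option nat := if v < 2 ^ w then Some v else None.

Fixpoint eval (w : nat) (s : state) (e : expr) : option nat :=
  match e with
  | Const v => word w v
  | Reg x => Some (regs s x)
  | Read a e1 => omap (mem s a) (eval w s e1)
  | Bin o e1 e2 =>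
      obind (fun u => obind (fun v => word w (binop_val o u v)) (eval w s e2))
            (eval w s e1)
  end.

Fixpoint expr_cost (e : expr) : nat :=
  match e with
  | Const _ | Reg _ => 1
  | Read _ e1 => (expr_cost e1).+1
  | Bin _ e1 e2 => (expr_cost e1 + expr_cost e2).+1
  end.

(* [exec w p s t s']: on [w]-bit words, [p] started in [s] halts in [s'] after
   [t] unit-cost steps. *)
Inductive exec (w : nat) : cmd -> state -> nat -> state -> Prop :=
| exec_skip s : exec w Skip s 1 s
| exec_assign s x e v :
    eval w s e = Some v ->
    exec w (Assign x e) s (expr_cost e).+1 (set_reg s x v)
| exec_write s a e1 e2 i v :
    eval w s e1 = Some i -> eval w s e2 = Some v ->
    exec w (Write a e1 e2) s (expr_cost e1 + expr_cost e2).+1 (set_mem s a i v)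
| exec_seq p1 p2 s t1 s1 t2 s2 :
    exec w p1 s t1 s1 -> exec w p2 s1 t2 s2 ->
    exec w (Seq p1 p2) s (t1 + t2) s2
| exec_if s e v p1 p2 t s' :
    eval w s e = Some v ->
    exec w (if v != 0 then p1 else p2) s t s' ->
    exec w (If e p1 p2) s ((expr_cost e).+1 + t) s'
| exec_while_end s e p :
    eval w s e = Some 0 -> exec w (While e p) s (expr_cost e).+1 s
| exec_while_step s e v p t1 s1 t2 s2 :
    eval w s e = Some v -> v != 0 ->
    exec w p s t1 s1 -> exec w (While e p) s1 t2 s2 ->
    exec w (While e p) s ((expr_cost e).+1 + t1 + t2) s2.

Lemma exec_det w p s t1 s1 t2 s2 :
  exec w p s t1 s1 -> exec w p s t2 s2 -> t1 = t2 /\ s1 = s2.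
Proof.
move=> H1; elim: H1 t2 s2 => {p s t1 s1}; intros;
  match goal with H : exec _ _ _ ?t _ |- _ = ?t /\ _ => inversion H; subst end;
  repeat match goal with
  | H : ?a = Some _, H' : ?a = Some _ |- _ =>
      rewrite H in H'; injection H' as H'; subst
  | IH : forall t s', exec _ ?p ?s t s' -> _ /\ _, H : exec _ ?p ?s _ _ |- _ =>
      case: (IH _ _ H) => ? ?; subst; clear IH
  end; by [].
Qed.

(** * Input and output conventions *)

Definition codes (Sigma : finType) (s : seq Sigma) : seq nat :=
  [seq nat_of_ord (enum_rank x) | x <- s].

(* Registers 0, 1, 2 hold the lengths, and segments 0, 1, 2 the plain
   (uncompressed) character sequences; everything else is 0. *)
Definition input (Sigma : finType) (A B C : seq Sigma) : state :=
  State (nth 0 [:: size A; size B; size C])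
        (fun a => nth 0 (nth [::] [:: codes A; codes B; codes C] a)).

Definition output (s : state) : nat := regs s 0.

(* Main.v *)
(* Work with the LCS lengths of pairs of suffixes A[i..], B[j..].  Where the
   suffixes start with the same character, one may jump by the smaller of the
   two remaining run lengths d and add d; otherwise the LCS skips one of the two
   runs entirely.  Every jump lands on a cell in which i or j starts a run, so
   only the O(mN + nM) such cells are tabulated, and the value at an arbitrary
   cell still costs O(1).
   For C = a^K, the longest common subsequence containing a^K obeys the same
   recursion, except that in a matching cell it may also begin with a^K.  In that
   case a^K is embedded greedily in both suffixes and followed by an LCS of what
   remains.  These embeddings need not be considered inside a jump: if a
   solution starting with a^K is preceded by another a, it still starts with a^K. *)

Require Import Defs.
From mathcomp Require Import all_boot zify.
(* Again, so that [mem] denotes the memory of a state. *)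
Import Defs.

Set Implicit Arguments.
Unset Strict Implicit.
Unset Printing Implicit Defensive.

(** * Longest common subsequences with a property *)

Section Best.
Variable T : eqType.
Implicit Types (P : pred (seq T)) (u v Z : seq T).

(** Indexing the subsequences of [u] by bit masks makes the maximum finite. The value is [0] also
    when nothing qualifies. *)
Definition best P u v : nat :=
  \max_(m : (size u).-tuple bool | P (mask m u) && subseq (mask m u) v)
     size (mask m u).

Lemma best_ge P u v Z :
  P Z -> subseq Z u -> subseq Z v -> size Z <= best P u v.
Proof.
move=> PZ /subseqP[m sm EZ] Zv; rewrite EZ in PZ Zv *.
have /eqP sm' := sm.
by apply: (@leq_bigmax_cond _ _ (fun m : (size u).-tuple bool => size (mask m u))
  (Tuple sm')); rewrite PZ.
Qed.

Lemma best_le P u v l :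
  (forall Z, P Z -> subseq Z u -> subseq Z v -> size Z <= l) -> best P u v <= l.
Proof.
move=> H; apply/bigmax_leqP => m /andP[Pm mv].
by apply: H => //; apply: mask_subseq.
Qed.

Lemma best_ex P u v : 0 < best P u v ->
  exists Z, [/\ P Z, subseq Z u, subseq Z v & size Z = best P u v].
Proof.
rewrite /best => b_gt0.
have [m mP|noZ] := pickP (fun m : (size u).-tuple bool =>
    P (mask m u) && subseq (mask m u) v); last first.
  by rewrite big_pred0 // in b_gt0.
have c_gt0 : 0 < #|[pred m : (size u).-tuple bool |
    P (mask m u) && subseq (mask m u) v]| by apply/card_gt0P; exists m.
have [m1 /andP[Pm mv] ->] :=
  eq_bigmax_cond (fun m : (size u).-tuple bool => size (mask m u)) c_gt0.
by exists (mask m1 u); rewrite Pm mv mask_subseq.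
Qed.

Lemma best_leq P u v P' u' v' :
    (forall Z, P Z -> subseq Z u -> subseq Z v ->
       [/\ P' Z, subseq Z u' & subseq Z v']) ->
  best P u v <= best P' u' v'.
Proof. by move=> H; apply: best_le => Z p1 p2 p3; have [] := H Z p1 p2 p3; apply: best_ge. Qed.

Lemma best_size P u v : best P u v <= size u.
Proof. by apply: best_le => Z _ /size_subseq. Qed.

Lemma subseq_skip z Z x d u : z != x ->
  subseq (z :: Z) (nseq d x ++ u) = subseq (z :: Z) u.
Proof. by move=> /negbTE zx; elim: d => //= d IH; rewrite zx IH. Qed.

(** The first letter of a nonempty common subsequence differs from [x] or from [y], so the
    corresponding run is skipped as a whole. *)
Lemma best_mismatch P x y p q u v : x != y ->
  best P (nseq p x ++ u) (nseq q y ++ v) =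
  maxn (best P u (nseq q y ++ v)) (best P (nseq p x ++ u) v).
Proof.
move=> xy; apply/eqP; rewrite eqn_leq geq_max; apply/and3P; split.
- apply: best_le => -[|z Z] PZ Zu Zv //; rewrite leq_max.
  have [zx|zx] := eqVneq z x; last by rewrite best_ge // -(subseq_skip _ p _ zx).
  have zy : z != y by rewrite zx.
  by rewrite orbC best_ge // -(subseq_skip _ q _ zy).
- by apply: best_leq => Z -> ZU ->; rewrite (subseq_trans ZU) // suffix_subseq.
- by apply: best_leq => Z -> -> ZU; rewrite (subseq_trans ZU) // suffix_subseq.
Qed.

Lemma best_all_match x d u v :
  best predT (nseq d x ++ u) (nseq d x ++ v) = d + best predT u v.
Proof.
(* Even if fewer than [d] letters of [Z] are matched inside the run, deleting [d] letters leaves a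
   subsequence of [w]. *)
have drop_sub Z w : subseq Z (nseq d x ++ w) -> subseq (drop d Z) w.
  elim: d Z => [|d IH] [|z Z] //=; rewrite ?drop0 ?sub0seq //.
  case: eqP => _ //; first exact: IH.
  move=> /IH /=; case: d {IH} => [|d]/=; rewrite ?drop0 //.
    by move=> /(subseq_trans (subseq_cons _ _)).
  by move=> H; apply: subseq_trans H; rewrite -add1n -drop_drop; apply: drop_subseq.
apply/eqP; rewrite eqn_leq; apply/andP; split.
  apply: best_le => Z _ Zu Zv.
  apply: leq_trans (_ : d + size (drop d Z) <= _); first by rewrite size_drop; lia.
  by rewrite leq_add2l best_ge //; apply: drop_sub.
have [->|] := posnP (best predT u v).
  rewrite addn0 -[leqLHS](size_nseq d x).
  by apply: best_ge => //; apply: prefix_subseq.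
move=> /best_ex[Z [_ Zu Zv <-]].
rewrite -[X in X + _](size_nseq d x) -size_cat.
by apply: best_ge => //; apply: cat_subseq.
Qed.

(** * Common subsequences that contain or start with a^K *)

Variables (a : T) (K : nat).
Hypothesis K_gt0 : 0 < K.

(* [addp d g] adds [d] to a length [g], where [0] encodes infeasibility. *)
Definition addp d g := g + (0 < g) * d.

(* If x = a, a solution starting with a^K keeps doing so when another a is put in
   front of it, so only the first position of the jump can need [prefix]. *)
Lemma best_infix_match x d u v : 0 < d ->
  best (infix (nseq K a)) (nseq d x ++ u) (nseq d x ++ v) =
  maxn (best (prefix (nseq K a)) (nseq d x ++ u) (nseq d x ++ v))
       (addp d (best (infix (nseq K a)) u v)).
Proof.
move=> d_gt0; apply/eqP; rewrite eqn_leq geq_max; apply/and3P; split; last first.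
- rewrite /addp; have [->//|] := posnP (best _ u v).
  move=> /best_ex[Z [CZ Zu Zv <-]]; rewrite mul1n addnC.
  rewrite -[X in X + _](size_nseq d x) -size_cat.
  by apply: best_ge; rewrite ?infix_catl //; apply: cat_subseq.
- by apply: best_leq => Z /prefixW.
apply: best_le => Z; elim: d d_gt0 Z => // d IH _ Z CZ Zu Zv.
have KZ : 0 < size Z by apply: leq_trans K_gt0 _; rewrite -(size_nseq K a) size_infix.
case: Z CZ Zu Zv KZ => // z Z CZ Zu Zv _.
(* Nonemptiness of [Z] forces [g] to be positive, so that [addp] does count the extra letter. *)
have main0 : 0 < size Z -> forall e g, size Z <= maxn e (addp d g) -> e <= addp d g ->
    size (z :: Z) <= addp d.+1 g.
  by rewrite /addp /= => sZ e [|g]; rewrite ?leq_max ?mul1n ?mul0n; lia.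
have [zx|zx] := eqVneq z x; last first.
  (* A solution starting with a letter other than [x] skips the jump in both strings. *)
  rewrite subseq_skip // in Zu; rewrite subseq_skip // in Zv.
  have := best_ge CZ Zu Zv; rewrite leq_max /addp => H; apply/orP; right.
  by apply: leq_trans H _; apply: leq_addr.
move: (CZ); rewrite infix_consl => /orP[pCZ|pCZ].
  by rewrite leq_max (best_ge pCZ Zu Zv).
move: Zu Zv; rewrite zx /= eqxx => Zu Zv.
have sZ : 0 < size Z by apply: leq_trans K_gt0 _; rewrite -(size_nseq K a) size_infix.
have IHZ : size Z <= maxn (best (prefix (nseq K a)) (nseq d x ++ u) (nseq d x ++ v))
                        (addp d (best (infix (nseq K a)) u v)).
  (* For [d = 0] the induction hypothesis is void, but [Z] itself is a solution for [u] and [v]. *)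
  case: d IH {main0} Zu Zv => [_ Zu Zv|d IH Zu Zv]; last exact: IH.
  by rewrite leq_max /addp muln0 addn0 (best_ge pCZ) // orbT.
rewrite zx in main0; have [xa|xa] := eqVneq x a.
  move: IHZ; rewrite /= !leq_max => /orP[] sZle; apply/orP; [left|right]; last first.
    by move: sZle sZ; rewrite /addp; case: (best _ _ _) => [|g]; lia.
  have := leq_trans sZ sZle => /best_ex[Y [pY Yu Yv eY]]; rewrite -eY in sZle.
  apply: leq_trans (_ : (size (a :: Y)) <= _) => //.
  apply: best_ge; [|by rewrite xa /= eqxx -xa..].
  case/prefixP: pY => W ->; rewrite -cat_cons.
  by rewrite -[a :: nseq K a]/(nseq K.+1 a) -addn1 nseqD -catA prefix_prefix.
rewrite leq_max (main0 sZ _ _ IHZ) ?orbT //.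
(* As [x] differs from [a], a sequence starting with [a] skips the run of [x], so the prefix term is
   bounded by the value after the jump. *)
apply: leq_trans (_ : _ <= best (infix (nseq K a)) u v) _; last exact: leq_addr.
apply: best_leq => Y pY Yu Yv; rewrite prefixW //.
case: Y pY Yu Yv => [|y Y]; first by case: (K) K_gt0.
have : nseq K a = a :: nseq K.-1 a by case: (K) K_gt0.
move=> -> /=; case: eqP => // <- _.
by rewrite !subseq_skip // eq_sym.
Qed.

(** Length of the shortest prefix of [u] with [k] occurrences of [a], or of all of [u] when there
    are fewer. *)
Fixpoint greedy k u : nat :=
  match u, k with
  | x :: u', k'.+1 => (greedy (if x == a then k' else k) u').+1
  | _, _ => 0
  end.

(** Matching each [a] as early as possible leaves the longest suffix for [Y]. *)
Lemma subseq_greedy k u Y : subseq (nseq k a ++ Y) u =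
  (k <= count_mem a u) && subseq Y (drop (greedy k u) u).
Proof.
elim: u k => [|x u IH] [|k] //=.
rewrite eq_sym; case: (x == a); first by rewrite IH.
by rewrite (IH k.+1).
Qed.

Lemma greedy_gt k u : 0 < k <= count_mem a u -> 0 < greedy k u.
Proof. by case: u k => [|x u] [|k]. Qed.

Lemma greedy_size k u : greedy k u <= size u.
Proof. by elim: u k => [|x u IH] [|k] //=; rewrite ltnS; case: eqP. Qed.

Lemma best_prefix u v : best (prefix (nseq K a)) u v =
  if (K <= count_mem a u) && (K <= count_mem a v)
  then K + best predT (drop (greedy K u) u) (drop (greedy K v) v) else 0.
Proof.
case: andP => [[Ku Kv]|H]; last first.
  apply/eqP; rewrite -leqn0; apply: best_le => Z /prefixP[Y ->].
  by rewrite !subseq_greedy => /andP[? _] /andP[? _]; case: H.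
apply/eqP; rewrite eqn_leq; apply/andP; split.
  apply: best_le => Z /prefixP[Y ->].
  rewrite !subseq_greedy => /andP[_ Yu] /andP[_ Yv].
  by rewrite size_cat size_nseq leq_add2l best_ge.
(* A zero value yields no witness through [best_ex]; in that case a^K alone attains the bound. *)
set b := (X in K + X); have [->|] := posnP b.
  rewrite addn0 -[leqLHS](size_nseq K a) -[X in size X]cats0.
  by apply: best_ge; rewrite ?subseq_greedy ?sub0seq ?prefix_prefix ?Ku ?Kv.
rewrite /b => /best_ex[Z [_ Zu Zv <-]].
rewrite -[X in X + _](size_nseq K a) -size_cat.
by apply: best_ge; rewrite ?subseq_greedy ?prefix_prefix ?Ku ?Kv.
Qed.

End Best.

(** * Runs *)

Section Runs.
Variable T : eqType.
Variable x0 : T.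
Implicit Types s : seq T.

(** On the last letter the test compares with the default [x0], but either branch then returns
    [1]. *)
Fixpoint head_run s : nat :=
  match s with
  | [::] => 0
  | x :: s' => if head x0 s' == x then (head_run s').+1 else 1
  end.

Lemma head_run_le s : head_run s <= size s.
Proof. by elim: s => //= x s IH; case: ifP. Qed.

Lemma head_run_gt0 s : (0 < head_run s) = (0 < size s).
Proof. by case: s => //= x s; case: ifP. Qed.

Lemma head_runE s d : d <= head_run s -> s = nseq d (head x0 s) ++ drop d s.
Proof.
elim: s d => [|x s IH] [|d] //=; case: ifP => [/eqP hx|_]; rewrite ltnS => hd.
  by rewrite -hx -IH.
by case: d hd; rewrite // drop0.
Qed.

Definition run_end s i := i + head_run (drop i s).

Lemma run_end_ge s i : i <= run_end s i. Proof. exact: leq_addr. Qed.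

Lemma run_end_gt s i : i < size s -> i < run_end s i.
Proof.
by move=> i_lt; rewrite -addn1 leq_add2l head_run_gt0 size_drop subn_gt0.
Qed.

Lemma run_end_le s i : i <= size s -> run_end s i <= size s.
Proof.
move=> i_le; have := head_run_le (drop i s).
by rewrite /run_end size_drop; lia.
Qed.

Lemma run_end_size s : run_end s (size s) = size s.
Proof. by rewrite /run_end drop_size addn0. Qed.

(** The recurrence for a scan from right to left. At the last position the comparison reads the
    default [x0]; both branches then equal [size s]. *)
Lemma run_end_rec s i : i < size s ->
  run_end s i = if nth x0 s i == nth x0 s i.+1 then run_end s i.+1 else i.+1.
Proof.
move=> i_lt; rewrite /run_end (drop_nth x0) //= -nth0 nth_drop addn0 eq_sym.
by case: eqP; rewrite ?addn1 // addnS.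
Qed.

(** The end of the string counts as a start because jumps may land there. *)
Definition run_start s i :=
  [|| i == 0, nth x0 s i.-1 != nth x0 s i | i == size s].

Lemma run_start_end s i : i <= size s -> run_start s (run_end s i).
Proof.
have [n Hn] := ubnP (size s - i); elim: n i Hn => // n IH i Hn.
rewrite leq_eqVlt => /orP[/eqP->|i_lt].
  by rewrite run_end_size /run_start eqxx !orbT.
rewrite run_end_rec //; case: ifP => [_|/negbT neq]; first by apply: IH; lia.
by rewrite /run_start /= neq.
Qed.

Fixpoint start_of s j :=
  if j is j'.+1 then
    if nth x0 s j' == nth x0 s j then start_of s j' else j
  else 0.

Lemma start_of_le s j : start_of s j <= j.
Proof. by elim: j => //= j IH; case: ifP => // _; apply: leqW. Qed.

Lemma run_start_start_of s j : run_start s (start_of s j).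
Proof. by elim: j => //= j IH; case: ifP => // H; rewrite /run_start /= H. Qed.

Lemma start_of_gap s j k :
  j < size s -> start_of s j < k <= j -> ~~ run_start s k.
Proof.
elim: j => [|j IH] /= j_lt; first by lia.
case: ifP => [eqj|_]; last by lia.
case/andP => lt_k; rewrite leq_eqVlt => /orP[/eqP->|k_le].
  by rewrite /run_start /= eqj /=; lia.
by apply: IH; lia.
Qed.

Lemma start_of_id s j : j < size s -> (start_of s j == j) = run_start s j.
Proof.
move=> j_lt; case: eqP => [<-|neq]; first by rewrite run_start_start_of.
apply/esym/negbTE/(start_of_gap j_lt); have := start_of_le s j; lia.
Qed.

Definition nstarts s j := \sum_(i < j) run_start s i.

Lemma nstartsS s j : nstarts s j.+1 = nstarts s j + run_start s j.
Proof. exact: big_ord_recr. Qed.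

(** From [start_of s j] to [j] only the former starts a run, so leaping from [j.+1] to it passes
    exactly one start. *)
Lemma nstarts_start_of s j : j < size s ->
  nstarts s j.+1 = (nstarts s (start_of s j)).+1.
Proof.
elim: j => [|j IH] j_lt; first by rewrite nstartsS addn1.
rewrite nstartsS -start_of_id //=; case: ifP => [eqj|_]; last by rewrite eqxx addn1.
have := start_of_le s j; rewrite IH; last exact: ltnW.
by case: eqP; lia.
Qed.

Lemma rle_cons y s : exists l r, rle (y :: s) = (y, l) :: r.
Proof.
by rewrite /=; case: (rle s) => [|[z l] r]; [|case: eqP => [->|_]]; do 2!eexists.
Qed.

Lemma size_rle_cons x y s :
  size (rle (x :: y :: s)) = (x != y) + size (rle (y :: s)).
Proof.
have [l [r E]] := rle_cons y s; rewrite [rle (x :: _)]/= -/(rle (y :: s)) E.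
by case: eqP.
Qed.

Lemma nstarts_size s : nstarts s (size s) = size (rle s).
Proof.
pose start' (t : seq T) i := (i == 0) || (nth x0 t i.-1 != nth x0 t i).
transitivity (\sum_(i < size s) start' s i).
  by apply: eq_bigr => i _; rewrite /run_start /start' (ltn_eqF (ltn_ord i)) orbF.
elim: s => [|x [|y s] IH]; [by rewrite big_ord0|by rewrite big_ord1|].
rewrite size_rle_cons -IH big_ord_recl big_ord_recl [in RHS]big_ord_recl /=.
by rewrite /start' /= addnCA.
Qed.

End Runs.

(** * Program logic *)

Arguments upd {T} f x v y /.

Section ProgramLogic.
Variable w : nat.

(** Evaluation over unbounded numbers; the overflow conditions are split off into [safe]. *)
Fixpoint val s e : nat :=
  match e with
  | Const v => v
  | Reg x => regs s x
  | Read a e1 => mem s a (val s e1)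
  | Bin o e1 e2 => binop_val o (val s e1) (val s e2)
  end.

Fixpoint safe s e : Prop :=
  match e with
  | Const v => v < 2 ^ w
  | Reg _ => True
  | Read _ e1 => safe s e1
  | Bin o e1 e2 =>
      [/\ safe s e1, safe s e2 &
          match o with
          | Eq | Leq => True
          | _ => binop_val o (val s e1) (val s e2) < 2 ^ w
          end]
  end.

Lemma eval_safe s e : 0 < w -> safe s e -> eval w s e = Some (val s e).
Proof.
move=> w_gt0; have w1 b : nat_of_bool b < 2 ^ w.
  by apply: leq_ltn_trans (leq_b1 b) _; rewrite -(expn0 2) ltn_exp2l.
elim: e => [v|x|a e IH|o e1 IH1 e2 IH2] //=; first by rewrite /word => ->.
  by move=> /IH->.
case=> /IH1-> /IH2-> H /=.
by rewrite /word; case: o H => /= [->|->|->|_|_] //; rewrite w1.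
Qed.

(** * Frame conditions from the syntactic footprint of a command *)

Fixpoint written_regs p : seq nat :=
  match p with
  | Assign x _ => [:: x]
  | Seq p1 p2 | If _ p1 p2 => written_regs p1 ++ written_regs p2
  | While _ p1 => written_regs p1
  | _ => [::]
  end.

Fixpoint written_segs p : seq nat :=
  match p with
  | Write a _ _ => [:: a]
  | Seq p1 p2 | If _ p1 p2 => written_segs p1 ++ written_segs p2
  | While _ p1 => written_segs p1
  | _ => [::]
  end.

Definition agree p s s' :=
  (forall x, x \notin written_regs p -> regs s' x = regs s x) /\
  (forall a, a \notin written_segs p -> mem s' a = mem s a).

Lemma agree_trans p s1 s2 s3 : agree p s1 s2 -> agree p s2 s3 -> agree p s1 s3.
Proof.
move=> [r12 m12] [r23 m23]; split=> [x xp|a ap]; first by rewrite r23 ?r12.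
by rewrite m23 ?m12.
Qed.

Lemma exec_agree p s t s' : exec w p s t s' -> agree p s s'.
Proof.
elim=> {p s t s'}.
- by [].
- by move=> s x e v _; split=> //= y; rewrite inE /upd => /negbTE->.
- by move=> s a e1 e2 i v _ _; split=> //= b; rewrite inE /upd => /negbTE->.
- move=> p1 p2 s t1 s1 t2 s2 _ [r1 m1] _ [r2 m2]; split=> x /=;
    rewrite mem_cat negb_or => /andP[x1 x2]; first by rewrite r2 ?r1.
  by rewrite m2 ?m1.
- move=> s e v p1 p2 t s' _ _ [r m]; split=> x /=;
    rewrite mem_cat negb_or => /andP[x1 x2]; [rewrite r|rewrite m] => //;
    by case: ifP.
- by [].
- by move=> s e v p t1 s1 t2 s2 _ _ _ a1 _ a2; apply: agree_trans a2.
Qed.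

(** Total correctness with a time bound: a halting run, hence one without overflow, must exist. *)
Definition wp p s T (Q : state -> Prop) :=
  exists t s', [/\ exec w p s t s', t <= T & Q s'].

Lemma wp_frame p s T (Q Q' : state -> Prop) : wp p s T Q ->
  (forall s', Q s' -> agree p s s' -> Q' s') -> wp p s T Q'.
Proof.
by move=> [t [s' [ex le_t Qs]]] H; exists t, s'; split=> //; apply: H (exec_agree ex).
Qed.

Lemma wp_leq p s T T' Q : wp p s T Q -> T <= T' -> wp p s T' Q.
Proof.
by move=> [t [s' [ex le_t Qs]]] le_T; exists t, s'; rewrite (leq_trans le_t).
Qed.

Lemma wp_seq p1 p2 s T1 T2 Q :
  wp p1 s T1 (fun s1 => wp p2 s1 T2 Q) -> wp (Seq p1 p2) s (T1 + T2) Q.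
Proof.
move=> [t1 [s1 [ex1 le1 [t2 [s2 [ex2 le2 Qs]]]]]].
by exists (t1 + t2), s2; split; rewrite ?leq_add //; apply: exec_seq ex2.
Qed.

(** * Symbolic execution of loop-free commands *)

Fixpoint loop_free p :=
  match p with
  | Seq p1 p2 | If _ p1 p2 => loop_free p1 && loop_free p2
  | While _ _ => false
  | _ => true
  end.

(** Counting both branches of a conditional gives an upper bound that depends on the syntax
    alone. *)
Fixpoint cost p : nat :=
  match p with
  | Skip => 1
  | Assign _ e => (expr_cost e).+1
  | Write _ e1 e2 => (expr_cost e1 + expr_cost e2).+1
  | Seq p1 p2 => cost p1 + cost p2
  | If e p1 p2 => (expr_cost e).+1 + (cost p1 + cost p2)
  | While _ _ => 0
  end.

Fixpoint vc p (Q : state -> Prop) s : Prop :=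
  match p with
  | Skip => Q s
  | Assign x e => safe s e /\ Q (set_reg s x (val s e))
  | Write a e1 e2 =>
      [/\ safe s e1, safe s e2 & Q (set_mem s a (val s e1) (val s e2))]
  | Seq p1 p2 => vc p1 (vc p2 Q) s
  | If e p1 p2 =>
      [/\ safe s e, val s e != 0 -> vc p1 Q s & val s e = 0 -> vc p2 Q s]
  | While _ _ => True
  end.

(** The rule of consequence with a frame: facts about untouched registers and segments need not be
    carried through [Q]. *)
Lemma vc_cut p (Q Q' : state -> Prop) s :
  vc p Q s -> (forall s', Q s' -> agree p s s' -> Q' s') -> vc p Q' s.
Proof.
elim: p Q Q' s => //= [|x e|a e1 e2|p1 IH1 p2 IH2|e p1 IH1 p2 IH2] Q Q' s.
- by move=> Qs; apply.
- move=> [se Qs] H; split=> //; apply: H => //.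
  by split=> //= y; rewrite inE /upd => /negbTE->.
- move=> [se1 se2 Qs] H; split=> //; apply: H => //.
  by split=> //= b; rewrite inE /upd => /negbTE->.
- move=> vc1 H; apply: IH1 vc1 _ => s1 vc2 [r1 m1]; apply: IH2 vc2 _ => s2 Qs [r2 m2].
  apply: H => //; split=> x /=; rewrite mem_cat negb_or => /andP[x1 x2].
    by rewrite r2 ?r1.
  by rewrite m2 ?m1.
- move=> [se vc1 vc2] H; split=> // v; [apply: IH1 (vc1 v) _|apply: IH2 (vc2 v) _];
    move=> s' Qs [r m]; apply: H => //; split=> x /=;
    by rewrite mem_cat negb_or => /andP[x1 x2]; rewrite ?r ?m.
Qed.

Lemma vc_seq p1 p2 (Q1 Q : state -> Prop) s :
  vc p1 Q1 s -> (forall s1, Q1 s1 -> agree p1 s s1 -> vc p2 Q s1) ->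
  vc (Seq p1 p2) Q s.
Proof. exact: vc_cut. Qed.

Lemma vc_if e p1 p2 Q s :
  safe s e -> (val s e != 0 -> vc p1 Q s) -> (val s e = 0 -> vc p2 Q s) ->
  vc (If e p1 p2) Q s.
Proof. by []. Qed.

Hypothesis w_gt0 : 0 < w.

Lemma wp_vc p s Q : loop_free p -> vc p Q s -> wp p s (cost p) Q.
Proof.
elim: p s Q => //= [|x e|a e1 e2|p1 IH1 p2 IH2|e p1 IH1 p2 IH2] s Q.
- by exists 1, s; split=> //; apply: exec_skip.
- move=> _ [/(eval_safe w_gt0) ev Qs]; eexists; eexists; split; last exact: Qs.
    exact: exec_assign.
  by [].
- move=> _ [/(eval_safe w_gt0) ev1 /(eval_safe w_gt0) ev2 Qs].
  eexists; eexists; split; last exact: Qs.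
    exact: exec_write.
  by [].
- move=> /andP[l1 l2] /(IH1 _ _ l1) H; apply: wp_seq.
  by apply: (wp_frame H) => s' /(IH2 _ _ l2).
- move=> /andP[l1 l2] [/(eval_safe w_gt0) ev H1 H2].
  case: (eqVneq (val s e) 0) => [e0|en0].
    have [t [s' [ex le Qs]]] := IH2 _ _ l2 (H2 e0).
    exists ((expr_cost e).+1 + t), s'; split=> //; last by lia.
    by apply: exec_if ev _; rewrite e0.
  have [t [s' [ex le Qs]]] := IH1 _ _ l1 (H1 en0).
  exists ((expr_cost e).+1 + t), s'; split=> //; last by lia.
  by apply: exec_if ev _; rewrite en0.
Qed.

(* The index of [Inv] is a potential, bounding the time that the remaining
   iterations take. *)
Lemma wp_while (Inv : nat -> state -> Prop) e p s0 n0 Q :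
    (forall n s, agree p s0 s -> Inv n s -> [/\ safe s e, val s e = 0 -> Q s &
       val s e != 0 -> exists T, wp p s T (fun s' =>
          exists2 n', (expr_cost e).+1 + T + n' <= n & Inv n' s')]) ->
  Inv n0 s0 -> wp (While e p) s0 (n0 + (expr_cost e).+1) Q.
Proof.
move=> step; suff main n s : agree p s0 s -> Inv n s ->
    wp (While e p) s (n + (expr_cost e).+1) Q by apply: main.
(* Each iteration lowers the potential by at least the cost of the test, which is positive. *)
have [m] := ubnP n; elim: m n s => // m IH n s n_lt ag inv.
have [/(eval_safe w_gt0) ev Q0 body] := step n s ag inv.
case: (eqVneq (val s e) 0) => [e0|en0].
  exists (expr_cost e).+1, s; split; [|exact: leq_addl|exact: Q0].
  by apply: exec_while_end; rewrite ev e0.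
have [T [t1 [s1 [ex1 le1 [n' le_n inv1]]]]] := body en0.
have [|t2 [s2 [ex2 le2 Qs]]] := IH n' s1 _ (agree_trans ag (exec_agree ex1)) inv1.
  by lia.
exists ((expr_cost e).+1 + t1 + t2), s2; split=> //; first exact: exec_while_step ev en0 ex1 ex2.
by lia.
Qed.

End ProgramLogic.

(** * Preprocessing one string *)

Local Notation "e1 @+ e2" := (Bin Add e1 e2) (at level 50, left associativity).
Local Notation "e1 @- e2" := (Bin Sub e1 e2) (at level 50, left associativity).
Local Notation "e1 @* e2" := (Bin Mul e1 e2) (at level 40, left associativity).
Local Notation "e1 @= e2" := (Bin Eq e1 e2) (at level 70).
Local Notation "e1 @<= e2" := (Bin Leq e1 e2) (at level 70).
Local Notation "p ;; q" := (Seq p q) (at level 90, right associativity).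

(* Registers 3 and 4 hold the current positions in A and B, register 5 the number
   of a's seen so far.  For string q (0 for A, 1 for B), segment 3 + q holds the
   end of the run at each position, 5 + q its start, and 7 + q the end of the
   greedy embedding of a^K from that position, or 0 if there is none.  Segment 9
   holds the ends of the a's, from right to left.  Segments 10 and 11 are the
   tables of the LCS and of the LCS containing a^K. *)
Definition back_run (q : nat) : cmd :=
  If (Read q (Reg 3) @= Read q (Reg 3 @+ Const 1))
     (Write q.+3 (Reg 3) (Read q.+3 (Reg 3 @+ Const 1)))
     (Write q.+3 (Reg 3) (Reg 3 @+ Const 1)).

Definition back_occ (q : nat) : cmd :=
  If (Read q (Reg 3) @= Read 2 (Const 0))
     (Write 9 (Reg 5) (Reg 3 @+ Const 1) ;; Assign 5 (Reg 5 @+ Const 1))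
     Skip.

(** With [c] occurrences stored from right to left, the K-th one of the current suffix has index
    [c - K]; a^K ends there. *)
Definition back_greedy (q : nat) : cmd :=
  If (Reg 2 @<= Reg 5)
     (Write q.+3.+4 (Reg 3) (Read 9 (Reg 5 @- Reg 2)))
     (Write q.+3.+4 (Reg 3) (Const 0)).

Definition scan_back (q : nat) : cmd :=
  Assign 3 (Reg 3 @- Const 1) ;; back_run q ;; back_occ q ;; back_greedy q.

Definition scan_forth (q : nat) : cmd :=
  If (Read q (Reg 3 @- Const 1) @= Read q (Reg 3))
     (Write q.+3.+2 (Reg 3) (Read q.+3.+2 (Reg 3 @- Const 1)))
     (Write q.+3.+2 (Reg 3) (Reg 3)) ;;
  Assign 3 (Reg 3 @+ Const 1).

(** The pass from right to left finds run ends and greedy ends, the pass from left to right finds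
    run starts. The truncated difference in the last test acts as a strict comparison. *)
Definition scan (q : nat) : cmd :=
  (Write q.+3 (Reg q) (Reg q) ;; Assign 3 (Reg q) ;; Assign 5 (Const 0)) ;;
  While (Reg 3) (scan_back q) ;;
  (Write q.+3.+2 (Const 0) (Const 0) ;; Assign 3 (Const 1)) ;;
  While (Reg q @- Reg 3) (scan_forth q).

(** For positive [K] a genuine end lies beyond [i], so [0] is free to mark absence. *)
Definition greedy_end (a K : nat) (s : seq nat) (i : nat) : nat :=
  if K <= count_mem a (drop i s) then i + greedy a K (drop i s) else 0.

Lemma greedy_end_bounds a K s i : 0 < K -> i < size s ->
  greedy_end a K s i != 0 -> i < greedy_end a K s i <= size s.
Proof.
rewrite /greedy_end => K_gt0 i_lt; case: ifP => // Kc _.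
have g_gt : 0 < greedy a K (drop i s) by rewrite greedy_gt ?K_gt0.
have g_le : greedy a K (drop i s) <= size s - i by rewrite -size_drop greedy_size.
lia.
Qed.

Local Ltac conj := repeat match goal with
  | |- True => exact: I
  | |- _ /\ _ => split
  | |- and3 _ _ _ => split
  end.

Section Scan.
Variables (w a K : nat) (A : seq nat).
Hypotheses (K_gt0 : 0 < K) (w_big : size A + 2 < 2 ^ w).

Let w_gt0 : 0 < w. Proof. by case: w w_big; rewrite // expn0; lia. Qed.

Definition scan_input q s :=
  [/\ regs s q = size A, regs s 2 = K, mem s 2 0 = a
    & forall i, mem s q i = nth 0 A i].

Lemma scan_input_agree p q s s' : scan_input q s -> agree p s s' ->
  [&& q \notin written_regs p, 2 \notin written_regs p,
      q \notin written_segs p & 2 \notin written_segs p] ->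
  scan_input q s'.
Proof.
move=> [rq r2s m2 mq] [rp mp] /and4P[q1 r1 q2 r2].
by rewrite /scan_input !rp ?mp.
Qed.

(** Segment 9 is a stack with the leftmost occurrence on top; the k-th [a] of the suffix is its k-th
    entry from the top. *)
Definition occurrences i s :=
  regs s 5 = count_mem a (drop i A) /\
  forall k, 0 < k <= count_mem a (drop i A) ->
    mem s 9 (count_mem a (drop i A) - k) = i + greedy a k (drop i A).

Definition back_inv q i s :=
  [/\ i <= size A, regs s 3 = i, occurrences i s,
      forall k, i <= k <= size A -> mem s q.+3 k = run_end 0 A k
    & forall k, i <= k < size A -> mem s q.+3.+4 k = greedy_end a K A k].

Lemma vc_back_run q i s : q < 2 -> scan_input q s ->
    regs s 3 = i -> i < size A ->
    (forall k, i < k <= size A -> mem s q.+3 k = run_end 0 A k) ->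
  vc w (back_run q) (fun s' =>
    forall k, i <= k <= size A -> mem s' q.+3 k = run_end 0 A k) s.
Proof.
move=> q_lt [rq r2 m2 mq] r3 i_lt mE.
have w1 : 1 < 2 ^ w by lia.
have wi : i + 1 < 2 ^ w by lia.
have step v : v = run_end 0 A i -> forall k, i <= k <= size A ->
    upd (mem s q.+3) i v k = run_end 0 A k.
  move=> -> k /andP[ik kA]; rewrite /=; case: eqP => [->//|/eqP ki].
  by rewrite mE // kA ltn_neqAle eq_sym ki ik.
rewrite /back_run /= r3 !mq !addn1 eqxx in wi *.
conj=> //; case: (nth 0 A i =P _) => // e _; conj=> //; apply: step;
  by rewrite run_end_rec //; case: eqP => // _; rewrite mE // ltnSn.
Qed.

Lemma vc_back_occ q i s : q < 2 -> scan_input q s ->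
    regs s 3 = i -> i < size A -> occurrences i.+1 s ->
  vc w (back_occ q) (occurrences i) s.
Proof.
move=> q_lt [rq r2 m2 mq] r3 i_lt [r5 m9].
have w0 : 0 < 2 ^ w by lia.
have w1 : 1 < 2 ^ w by lia.
have wi : i + 1 < 2 ^ w by lia.
have Ed := drop_nth 0 i_lt.
have c_le : count_mem a (drop i A) <= size A - i by rewrite -size_drop count_size.
rewrite /back_occ /= r3 !mq m2 /occurrences Ed /= r5 in c_le *.
case: (nth 0 A i =P a) c_le => //= Ai; rewrite ?add0n => c_le; conj=> // _; conj=> //.
- by lia.
- by rewrite add1n addn1.
(* The new entry is the first [a]. For the others both the rank and the number of occurrences grow
   by one, so the index stays. *)
- move=> [|k] k_le //=; case: eqP => [e|ne].
    have -> : k = 0 by lia.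
    by case: (drop i.+1 A).
  have k_gt0 : 0 < k by move: ne; case: (k) => //; rewrite add1n subSS subn0.
  by rewrite add1n subSS m9 ?addSnnS // k_gt0.

- by move=> [|k] k_le; rewrite // m9 //=; lia.
Qed.

Lemma vc_back_greedy q i s : q < 2 -> scan_input q s ->
    regs s 3 = i -> i < size A -> occurrences i s ->
    (forall k, i < k < size A -> mem s q.+3.+4 k = greedy_end a K A k) ->
  vc w (back_greedy q) (fun s' =>
    forall k, i <= k < size A -> mem s' q.+3.+4 k = greedy_end a K A k) s.
Proof.
move=> q_lt [rq r2 m2 mq] r3 i_lt [r5 m9] mG.
have w0 : 0 < 2 ^ w by lia.
have c_le : count_mem a (drop i A) <= size A - i by rewrite -size_drop count_size.
have cK : count_mem a (drop i A) - K < 2 ^ w.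
  by apply: leq_ltn_trans (leq_subr _ _) _; apply: leq_ltn_trans c_le _; lia.
have step v : v = greedy_end a K A i -> forall k, i <= k < size A ->
    upd (mem s q.+3.+4) i v k = greedy_end a K A k.
  move=> -> k /andP[ik kA]; rewrite /=; case: eqP => [->//|/eqP ki].
  by rewrite mG // kA ltn_neqAle eq_sym ki ik.
rewrite /back_greedy /= r3 r5 r2 eqxx.
conj=> //; case: (leqP K (count_mem a (drop i A))) => // Kc _; conj=> //; apply: step; rewrite /greedy_end.
  by rewrite Kc m9 ?K_gt0.
by rewrite leqNgt Kc.
Qed.

Lemma vc_scan_back q i s : q < 2 -> scan_input q s -> back_inv q i.+1 s ->
  vc w (scan_back q) (back_inv q i) s.
Proof.
(* For concrete [q] the footprint conditions compute to [true]. *)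
case: q => [|[|//]] q_lt si [i_lt r3 occ mE mG];
  (apply: (@vc_seq _ _ _ (fun s1 => regs s1 3 = i));
     [by rewrite /= r3; conj; lia|]) => s1 r13 ag1;
  (have si1 := scan_input_agree si ag1 isT);
  (have mE1 := mE; rewrite -(ag1.2 _ isT) in mE1);
  apply: (vc_seq (vc_back_run q_lt si1 r13 i_lt mE1)) => s2 mE2 ag2;
  (have si2 := scan_input_agree si1 ag2 isT);
  (have r23 : regs s2 3 = i by rewrite ag2.1);
  (have occ2 : occurrences i.+1 s2
     by rewrite /occurrences ag2.1 ?ag2.2 ?ag1.1 ?ag1.2);
  apply: (vc_seq (vc_back_occ q_lt si2 r23 i_lt occ2)) => s3 occ3 ag3;
  (have si3 := scan_input_agree si2 ag3 isT);
  (have r33 : regs s3 3 = i by rewrite ag3.1);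
  (rewrite -ag1.2 // -ag2.2 // -ag3.2 // in mG);
  apply: (vc_cut (vc_back_greedy q_lt si3 r33 i_lt occ3 mG)) => s4 mG4 ag4;
  split=> //; rewrite ?ag4.1 ?ag4.2 ?ag3.2 // ?(ltnW i_lt) //;
  by rewrite /occurrences ag4.1 // ag4.2.
Qed.

Definition forth_inv q i s :=
  [/\ 0 < i, regs s 3 = i & forall k, k < i -> mem s q.+3.+2 k = start_of 0 A k].

Lemma vc_scan_forth q i s : q < 2 -> scan_input q s -> i < size A ->
  forth_inv q i s -> vc w (scan_forth q) (forth_inv q i.+1) s.
Proof.
move=> q_lt [rq r2 m2 mq] i_lt [i_gt0 r3 mS].
have [w1 wi] : 1 < 2 ^ w /\ i + 1 < 2 ^ w by lia.
have wi1 : i - 1 < 2 ^ w by lia.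
have step v : v = start_of 0 A i -> forall k, k < i.+1 ->
    upd (mem s q.+3.+2) i v k = start_of 0 A k.
  move=> -> k; rewrite ltnS leq_eqVlt /=; case: eqP => [->//|_] /= ki.
  exact: mS.
have start_i : start_of 0 A i =
    if nth 0 A (i - 1) == nth 0 A i then start_of 0 A (i - 1) else i.
  by case: (i) i_gt0 => // j _; rewrite subn1.
rewrite /scan_forth /= r3 !mq /forth_inv /=.
case: (nth 0 A (i - 1) =P _) start_i => //= _ start_i; conj=> // _; conj;
  rewrite ?addn1 ?eqxx //; try lia; apply: step => //.
by rewrite mS // subn1 prednK.
Qed.

Definition scanned q s :=
  [/\ forall k, k <= size A -> mem s q.+3 k = run_end 0 A k,
      forall k, k < size A -> mem s q.+3.+2 k = start_of 0 A k
    & forall k, k < size A -> mem s q.+3.+4 k = greedy_end a K A k].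

Lemma wp_scan q s : q < 2 -> scan_input q s ->
  wp w (scan q) s (100 * (size A).+1) (scanned q).
Proof.
(* The body of each loop together with its test, which costs 2 and 4 steps. *)
move=> q_lt si; have [w1 wA] : 1 < 2 ^ w /\ size A < 2 ^ w by lia.
pose cb := cost (scan_back q) + 2; pose cf := cost (scan_forth q) + 4.
have [cbE cfE] : cb = 54 /\ cf = 25 by [].
apply: (@wp_leq _ _ _ (7 + ((size A * cb + 2) + (5 + (size A * cf + 4)))));
  last by rewrite cbE cfE; lia.
apply: wp_seq; have [rq _ _ _] := si.
have init : vc w (Write q.+3 (Reg q) (Reg q) ;; Assign 3 (Reg q) ;; Assign 5 (Const 0))
    (back_inv q (size A)) s.
  rewrite /= rq; conj=> //; first by lia.
  rewrite /back_inv /occurrences /= drop_size; split=> //=.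
  - by split=> // k; case: k.
  - by move=> k; rewrite -eqn_leq eqxx => /eqP <-; rewrite /= eqxx run_end_size.
  - by move=> k; lia.
apply: (wp_frame (wp_vc w_gt0 _ init)) => // s1 inv1 ag1.
have si1 : scan_input q s1.
  by apply: (scan_input_agree si ag1); case: (q) q_lt => [|[|]].
apply: wp_seq; have := @wp_while w w_gt0
  (fun n s => exists2 i, n = i * cb & back_inv q i s) (Reg 3) (scan_back q) s1.
move=> /(_ _ (back_inv q 0)) loop1.
apply: (wp_frame (loop1 _ _ _)) => {loop1}.
- move=> n s2 ag2 [i -> inv2]; have [_ r3 _ _ _] := inv2.
  split=> //=; rewrite r3; first by move=> i0; rewrite i0 in inv2.
  case: i inv2 {r3} => // i inv2 _; exists (cost (scan_back q)).
  have si2 : scan_input q s2.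
    by apply: (scan_input_agree si1 ag2); case: (q) q_lt => [|[|]].
  apply: (wp_frame (wp_vc w_gt0 _ (vc_scan_back q_lt si2 inv2))) => // s3 inv3 _.
  by exists (i * cb); [rewrite mulSn /cb; lia | exists i].
- by exists (size A).
move=> s2 [_ _ _ mE mG] ag2.
have si2 : scan_input q s2.
  by apply: (scan_input_agree si1 ag2); case: (q) q_lt => [|[|]].
apply: wp_seq; have [rq2 _ _ _] := si2.
have init2 : vc w (Write q.+3.+2 (Const 0) (Const 0) ;; Assign 3 (Const 1))
    (forth_inv q 1) s2.
  by conj => //=; conj; try lia; split=> // -[|k] //=; rewrite eqxx.
apply: (wp_frame (wp_vc w_gt0 _ init2)) => // s3 inv3 ag3.
have si3 : scan_input q s3.
  by apply: (scan_input_agree si2 ag3); case: (q) q_lt => [|[|]].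
have := @wp_while w w_gt0
  (fun n s => exists2 i, n = (size A - i) * cf & forth_inv q i s)
  (Reg q @- Reg 3) (scan_forth q) s3.
(* An inequality, because on an empty string the loop starts at 1, already beyond the end. *)
move=> /(_ _ (fun s => exists2 i, size A <= i & forth_inv q i s)) loop2.
apply: (wp_frame (wp_leq (loop2 ((size A - 1) * cf) _ _) _)) => {loop2}.
- move=> n s4 ag4 [i -> inv4]; have [_ r3 _] := inv4.
  have si4 : scan_input q s4.
    by apply: (scan_input_agree si3 ag4); case: (q) q_lt => [|[|]].
  have [rq4 _ _ _] := si4.
  rewrite /= rq4 r3; split=> //; first by conj; lia.
    by move=> i0; exists i => //; lia.
  move=> i_lt; exists (cost (scan_forth q)).
  have {}i_lt : i < size A by lia.
  apply: (wp_frame (wp_vc w_gt0 _ (vc_scan_forth q_lt si4 i_lt inv4))) => // s5 inv5 _.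
  exists ((size A - i.+1) * cf); last by exists i.+1.
  by rewrite cfE; change (cost (scan_forth q)) with 21; lia.
- by exists 1.
- by rewrite leq_add2r leq_mul2r leq_subr orbT.
move=> s4 [i i_ge [_ _ mS]] ag4.
split=> k k_lt; last 2 first.
- by apply: mS; apply: leq_trans i_ge.
- rewrite ag4.2 ?ag3.2 ?mG //; by case: (q) q_lt => [|[|]].
- rewrite ag4.2 ?ag3.2 ?mE //; by case: (q) q_lt => [|[|]].
Qed.

End Scan.

(** * One cell of the tables *)

(* Both rely on subtraction being truncated. *)
Definition emin e1 e2 := e1 @- (e1 @- e2).
Definition emax e1 e2 := e1 @+ (e2 @- e1).

(** Row-major order with a column for the empty suffix of B. *)
Definition adr x y := x @* (Reg 1 @+ Const 1) @+ y.

(* The jump of the recursion from cell (x, y): the length d of the jump goes to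
   register 6, the table value where it lands to register r. *)
Definition fetch (t x y r : nat) : cmd :=
  If (Read 0 (Reg x) @= Read 1 (Reg y))
     (Assign 6 (emin (Read 3 (Reg x) @- Reg x) (Read 4 (Reg y) @- Reg y)) ;;
      Assign r (Read t (adr (Reg x @+ Reg 6) (Reg y @+ Reg 6))))
     (Assign 6 (Const 0) ;;
      Assign r (emax (Read t (adr (Read 3 (Reg x)) (Reg y)))
                     (Read t (adr (Reg x) (Read 4 (Reg y)))))).

Definition cell_lcs : cmd :=
  fetch 10 3 4 7 ;; Assign 7 (Reg 6 @+ Reg 7).

(** The comparison is the factor [0 < g] of [addp]: an infeasible value stays [0]. *)
Definition cell_infix : cmd :=
  fetch 11 3 4 8 ;; Assign 8 (Reg 8 @+ (Const 1 @<= Reg 8) @* Reg 6).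

(** The product is nonzero exactly when both embeddings exist. The cell where they end need not be
    tabulated, so its LCS is obtained by one more jump. *)
Definition cell_prefix : cmd :=
  (Assign 9 (Read 7 (Reg 3)) ;; Assign 10 (Read 8 (Reg 4))) ;;
  If (Reg 9 @* Reg 10)
     (fetch 10 9 10 11 ;; Assign 11 (Reg 6 @+ Reg 11 @+ Reg 2))
     (Assign 11 (Const 0)).

Definition store : cmd :=
  Write 10 (adr (Reg 3) (Reg 4)) (Reg 7) ;;
  Write 11 (adr (Reg 3) (Reg 4)) (emax (Reg 8) (Reg 11)).

Definition cell : cmd := cell_lcs ;; cell_infix ;; cell_prefix ;; store.

Section Cell.
Variables (w a K : nat) (A B : seq nat).
Local Notation M := (size A).
Local Notation N := (size B).
Hypotheses (K_gt0 : 0 < K) (w_big : 4 * (M.+1 * N.+1) <= 2 ^ w).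

Implicit Types P : pred (seq nat).

(** * The recursion on pairs of suffixes *)

Definition suff_best P i j := best P (drop i A) (drop j B).

(** Beyond the end the default [0] may equal a genuine letter code, but the remaining run is then
    empty and the jump has length [0]. *)
Definition dist i j :=
  if nth 0 A i == nth 0 B j then minn (run_end 0 A i - i) (run_end 0 B j - j) else 0.

Definition skip_best P i j :=
  if nth 0 A i == nth 0 B j then suff_best P (i + dist i j) (j + dist i j)
  else maxn (suff_best P (run_end 0 A i) j) (suff_best P i (run_end 0 B j)).

Lemma suff_best_le P i j : suff_best P i j <= M.
Proof. by apply: leq_trans (best_size _ _ _) _; rewrite size_drop leq_subr. Qed.

Lemma drop_head_run (s : seq nat) i d : d <= run_end 0 s i - i ->
  drop i s = nseq d (nth 0 s i) ++ drop (i + d) s.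
Proof.
rewrite /run_end addKn => d_le.
by rewrite {1}(head_runE d_le) -nth0 nth_drop addn0 drop_drop addnC.
Qed.

Lemma suff_best_mismatch P i j : nth 0 A i != nth 0 B j ->
  suff_best P i j = skip_best P i j.
Proof.
move=> neq; rewrite /skip_best (negbTE neq) /suff_best.
have [EA EB] := (drop_head_run (leqnn (run_end 0 A i - i)),
                 drop_head_run (leqnn (run_end 0 B j - j))).
rewrite !subnKC ?run_end_ge // in EA EB.
by rewrite EA EB best_mismatch.
Qed.

Lemma suff_best_match i j : nth 0 A i = nth 0 B j ->
  drop i A = nseq (dist i j) (nth 0 A i) ++ drop (i + dist i j) A /\
  drop j B = nseq (dist i j) (nth 0 A i) ++ drop (j + dist i j) B.
Proof.
move=> eqAB; rewrite /dist eqAB eqxx; split; last by apply/drop_head_run/geq_minr.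
by rewrite -eqAB; apply/drop_head_run/geq_minl.
Qed.

Lemma suff_best_all i j :
  suff_best predT i j = dist i j + skip_best predT i j.
Proof.
have [eqAB|neq] := eqVneq (nth 0 A i) (nth 0 B j); last first.
  by rewrite suff_best_mismatch // /dist (negbTE neq).
have [EA EB] := suff_best_match eqAB.
by rewrite {1}/suff_best EA EB best_all_match /skip_best eqAB eqxx.
Qed.

(** One formula covers all cells: without a proper jump the second term is already the full value,
    and it dominates the prefix term. *)
Lemma suff_best_infix i j : suff_best (infix (nseq K a)) i j =
  maxn (suff_best (prefix (nseq K a)) i j)
       (addp (dist i j) (skip_best (infix (nseq K a)) i j)).
Proof.
have le_pi : suff_best (prefix (nseq K a)) i j <= suff_best (infix (nseq K a)) i j.
  by apply: best_leq => Z /prefixW.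
have addp0 g : addp 0 g = g by rewrite /addp muln0 addn0.
have [eqAB|neq] := eqVneq (nth 0 A i) (nth 0 B j); last first.
  by rewrite -suff_best_mismatch // /dist (negbTE neq) addp0 (maxn_idPr _).
have [d0|d_gt0] := posnP (dist i j).
  by rewrite /skip_best eqAB eqxx d0 !addn0 addp0 (maxn_idPr _).
have [EA EB] := suff_best_match eqAB.
by rewrite {1 2}/suff_best EA EB best_infix_match // /skip_best eqAB eqxx.
Qed.

Lemma suff_best_prefix i j : suff_best (prefix (nseq K a)) i j =
  if greedy_end a K A i * greedy_end a K B j != 0
  then K + suff_best predT (greedy_end a K A i) (greedy_end a K B j) else 0.
Proof.
rewrite /suff_best best_prefix // /greedy_end muln_eq0 negb_or.
case: leqP => //= Ka; case: leqP => //= Kb; last by rewrite andbF.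
have gA : 0 < greedy a K (drop i A) by rewrite greedy_gt ?K_gt0.
have gB : 0 < greedy a K (drop j B) by rewrite greedy_gt ?K_gt0.
by rewrite -!lt0n !addn_gt0 gA gB !orbT !drop_drop !(addnC (greedy _ _ _)).
Qed.

(** * Correctness of the code for one cell *)

Definition dp_input s :=
  [/\ [/\ regs s 0 = M, regs s 1 = N & regs s 2 = K],
      forall i, mem s 0 i = nth 0 A i, forall j, mem s 1 j = nth 0 B j,
      scanned a K A 0 s & scanned a K B 1 s].

Lemma dp_input_agree p s s' : dp_input s -> agree p s s' ->
    all (fun x => x \notin written_regs p) (iota 0 3) &&
    all (fun b => b \notin written_segs p) (iota 0 9) ->
  dp_input s'.
Proof.
move=> [[r0 r1 r2] m0 m1 scA scB] [rp mp] /andP[/allP rn /allP mn].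
have r i : i < 3 -> regs s' i = regs s i by move=> lt; apply/rp/rn; rewrite mem_iota.
have m i : i < 9 -> mem s' i = mem s i by move=> lt; apply/mp/mn; rewrite mem_iota.
by rewrite /dp_input /scanned !r // !m.
Qed.

Definition boundary i j := run_start 0 A i || run_start 0 B j.

(* The entries that [fetch] may read; in the last row and column it reads its
   own cell. *)
Definition fetchable t P i j s :=
  forall i' j', i <= i' <= M -> j <= j' <= N ->
    [|| i < i', j < j', i == M | j == N] -> boundary i' j' ->
  mem s t (i' * N.+1 + j') = suff_best P i' j'.

Lemma word_size_gt0 : 0 < w.
Proof. by case: w w_big => //; rewrite expn0 -addn1; lia. Qed.

Lemma address_lt i j : i <= M -> j <= N -> i * N.+1 + j < M.+1 * N.+1.
Proof. by move=> iM jN; rewrite mulSn -addnS addnC leq_add // leq_mul2r iM orbT. Qed.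

(** Every jump ends at a run end in at least one string, which is a run start or the end of the
    string, hence at a tabulated cell. *)
Lemma vc_fetch t P x y r i j s : dp_input s -> x != 6 -> y != 6 -> r != 6 ->
    regs s x = i -> regs s y = j -> i <= M -> j <= N -> fetchable t P i j s ->
  vc w (fetch t x y r)
    (fun s' => regs s' 6 = dist i j /\ regs s' r = skip_best P i j) s.
Proof.
move=> [[r0 r1 r2] m0 m1 [EA _ _] [EB _ _]] /negbTE x6 /negbTE y6 /negbTE r6 rx ry iM jN fet.
have iEA := run_end_ge 0 A i; have jEB := run_end_ge 0 B j.
have EAM : run_end 0 A i <= M := run_end_le 0 iM.
have EBN : run_end 0 B j <= N := run_end_le 0 jN.
have MN : M < M.+1 * N.+1 /\ N < M.+1 * N.+1.
  by split; [rewrite mulnS|rewrite mulSn]; lia.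
have iEA' : (i < run_end 0 A i) || (i == M).
  by move: iM; rewrite leq_eqVlt => /orP[->|/run_end_gt->]; rewrite ?orbT.
have jEB' : (j < run_end 0 B j) || (j == N).
  by move: jN; rewrite leq_eqVlt => /orP[->|/run_end_gt->]; rewrite ?orbT.
have iEAw : run_end 0 A i < 2 ^ w by lia.
have jEBw : run_end 0 B j < 2 ^ w by lia.
have addrw x' y' : x' <= M -> y' <= N ->
    [/\ x' * N.+1 + y' < 2 ^ w, x' * N.+1 < 2 ^ w, x' < 2 ^ w & y' < 2 ^ w].
  by move=> xM yN; have := address_lt xM yN; split; lia.
have [_ _ w1 _] := addrw 0 0 isT isT.
have [aw1 aw2 aw3 aw4] := addrw _ _ EAM jN.
have [aw5 aw6 aw7 aw8] := addrw _ _ iM EBN.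
have wN : N + 1 < 2 ^ w by lia.
rewrite /fetch /= m0 m1 rx ry x6 y6 r1 r6 !EA // !EB // addn1.
rewrite /dist /skip_best /dist.
rewrite -!minnE -!maxnE eqxx (eq_sym 6) r6.
have -> : mem s t (run_end 0 A i * N.+1 + j) = suff_best P (run_end 0 A i) j.
  apply: fet; rewrite ?iEA ?leqnn ?jN ?andbT //; last by rewrite /boundary run_start_end.
  by case/orP: iEA' => ->; rewrite ?orbT.
have -> : mem s t (i * N.+1 + run_end 0 B j) = suff_best P i (run_end 0 B j).
  apply: fet; rewrite ?jEB ?leqnn ?iM ?andbT //; last by rewrite /boundary run_start_end ?orbT.
  by case/orP: jEB' => ->; rewrite ?orbT.
have maxw : maxn (suff_best P (run_end 0 A i) j) (suff_best P i (run_end 0 B j)) < 2 ^ w.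
  by apply: leq_ltn_trans (_ : M < _); [rewrite geq_max !suff_best_le | lia].
have subw : suff_best P i (run_end 0 B j) - suff_best P (run_end 0 A i) j < 2 ^ w.
  by apply: leq_ltn_trans (leq_subr _ _) _; move: maxw; rewrite gtn_max => /andP[].
have [eqAB|neq] := eqVneq (nth 0 A i) (nth 0 B j); last by conj=> //= _; conj=> //; lia.
set d := minn _ _.
have dM : i + d <= M by rewrite /d; lia.
have dN : j + d <= N by rewrite /d; lia.
have [dw1 dw2 dw3 dw4] := addrw _ _ dM dN.
have -> : mem s t ((i + d) * N.+1 + (j + d)) = suff_best P (i + d) (j + d).
  apply: fet; rewrite ?leq_addr ?dM ?dN //.
    move: iEA' jEB'; rewrite /d; case: eqP => [->|_]; first by rewrite !orbT.
    by case: eqP => [->|_]; rewrite ?orbT // !orbF; lia.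
  (* The shorter remaining run is used up completely, so its string is at a run end. *)
  have [d_le|d_le] := leqP (run_end 0 A i - i) (run_end 0 B j - j).
    by rewrite /d (minn_idPl d_le) subnKC // /boundary run_start_end.
  by rewrite /d (minn_idPr (ltnW d_le)) subnKC // /boundary orbC run_start_end.
by conj=> //= _; conj=> //; rewrite ?/d; lia.
Qed.

(** Rows are filled from the last to the first, each from right to left. The last column is correct
    from the start, hence included in every row. *)
Definition filled i j s := forall i' j', i' <= M -> j' <= N ->
    (j' == N) || boundary i' j' && ((i < i') || (i' == i) && (j <= j')) ->
  mem s 10 (i' * N.+1 + j') = suff_best predT i' j' /\
  mem s 11 (i' * N.+1 + j') = suff_best (infix (nseq K a)) i' j'.

Lemma filled_agree p i j s s' : filled i j s -> agree p s s' ->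
  (10 \notin written_segs p) && (11 \notin written_segs p) -> filled i j s'.
Proof. by move=> fi [_ mp] /andP[n10 n11]; rewrite /filled !mp. Qed.

(** Jumps are made from two cells while (i, j) is computed: from itself, and from the end of the
    greedy embeddings, which lies in a later row. *)
Lemma filled_fetchable i j x y s : filled i j.+1 s ->
    (i < x) || [&& x == i, y == j, i < M & j < N] ->
  fetchable 10 predT x y s /\ fetchable 11 (infix (nseq K a)) x y s.
Proof.
move=> fi ixy; suff cond i' j' : x <= i' <= M -> y <= j' <= N ->
    [|| x < i', y < j', x == M | y == N] -> boundary i' j' ->
    i' <= M /\ j' <= N /\
    (j' == N) || boundary i' j' && ((i < i') || (i' == i) && (j < j')).
  by split=> i' j' xi yj lt bd; have [iM [jN /(fi _ _ iM jN)[]]] := cond _ _ xi yj lt bd.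
move=> /andP[xi ->] /andP[yj ->] lt ->; rewrite /=; do 2!split=> //.
case/orP: ixy => [ix|/and4P[/eqP ex /eqP ey iM jN]]; first by rewrite (leq_trans ix) ?orbT.
by move: lt; rewrite ex ey (ltn_eqF iM) (ltn_eqF jN) !orbF; lia.
Qed.

Lemma vc_cell_lcs i j s : dp_input s -> filled i j.+1 s ->
    regs s 3 = i -> regs s 4 = j -> i < M -> j < N ->
  vc w cell_lcs (fun s' => regs s' 7 = suff_best predT i j) s.
Proof.
move=> di fi r3 r4 iM jN.
have [|fe _] := @filled_fetchable i j i j s fi; first by rewrite !eqxx iM jN orbT.
apply: (vc_seq (vc_fetch di _ _ _ r3 r4 (ltnW iM) (ltnW jN) fe)) => //.
move=> s1 [r6 r7] _; rewrite /= r6 r7 -suff_best_all; conj=> //.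
by apply: leq_ltn_trans (suff_best_le _ _ _) _; lia.
Qed.

Lemma addp_skip_best_le i j :
  addp (dist i j) (skip_best (infix (nseq K a)) i j) <= M.
Proof.
by apply: leq_trans (suff_best_le (infix (nseq K a)) i j); rewrite suff_best_infix leq_maxr.
Qed.

Lemma vc_cell_infix i j s : dp_input s -> filled i j.+1 s ->
    regs s 3 = i -> regs s 4 = j -> i < M -> j < N ->
  vc w cell_infix (fun s' =>
    regs s' 8 = addp (dist i j) (skip_best (infix (nseq K a)) i j)) s.
Proof.
move=> di fi r3 r4 iM jN.
have [|_ fe] := @filled_fetchable i j i j s fi; first by rewrite !eqxx iM jN orbT.
apply: (vc_seq (vc_fetch di _ _ _ r3 r4 (ltnW iM) (ltnW jN) fe)) => //.
move=> s1 [r6 r8] _; rewrite /= r6 r8; have := addp_skip_best_le i j.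
by rewrite /addp => le_M; conj=> //; lia.
Qed.

Lemma vc_cell_prefix i j s : dp_input s -> filled i j.+1 s ->
    regs s 3 = i -> regs s 4 = j -> i < M -> j < N ->
  vc w cell_prefix (fun s' => regs s' 11 = suff_best (prefix (nseq K a)) i j) s.
Proof.
move=> di fi r3 r4 iM jN; pose x := greedy_end a K A i; pose y := greedy_end a K B j.
have [_ _ _ [_ _ GA] [_ _ GB]] := di.
apply: (@vc_seq _ _ _ (fun s1 => regs s1 9 = x /\ regs s1 10 = y)).
  by rewrite /= r3 r4 GA // GB.
move=> s1 [r9 r10] ag1.
have di1 : dp_input s1 by apply: (dp_input_agree di ag1).
have fi1 := filled_agree fi ag1 isT.
have sbp := suff_best_prefix i j; rewrite -/x -/y in sbp.
have xM : x != 0 -> i < x <= M by apply: greedy_end_bounds.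
have yN : y != 0 -> j < y <= N by apply: greedy_end_bounds.
have xy_w : x * y < 2 ^ w.
  have [->|/xM/andP[_ xM']] := eqVneq x 0; first by lia.
  have [->|/yN/andP[_ yN']] := eqVneq y 0; first by lia.
  by apply: leq_ltn_trans (leq_mul xM' yN') _; have := w_big; rewrite mulSn mulnS; lia.
apply: vc_if => [|xy0|xy0]; first by rewrite /= r9 r10; conj.
  rewrite /= r9 r10 in xy0; have := xy0; rewrite muln_eq0 negb_or => /andP[x0 y0].
  have [/andP[ix xM'] /andP[jy yN']] := (xM x0, yN y0).
  have [|fe _] := @filled_fetchable i j x y s1 fi1; first by rewrite ix.
  apply: (vc_seq (vc_fetch di1 _ _ _ r9 r10 xM' yN' fe)) => // s2 [r6 r11] ag2.
  have [[_ _ r2] _ _ _ _] := dp_input_agree di1 ag2 isT.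
  rewrite xy0 in sbp.
  have le_M := suff_best_le (prefix (nseq K a)) i j.
  rewrite /= r6 r11 r2 -suff_best_all addnC -sbp; conj=> //; rewrite ?sbp.
    by apply: leq_ltn_trans (suff_best_le _ _ _) _; lia.
  by rewrite -sbp; lia.
rewrite /= r9 r10 in xy0; rewrite xy0 in sbp.
by rewrite sbp /=; conj=> //; lia.
Qed.

Lemma vc_store i j s : dp_input s -> filled i j.+1 s ->
    regs s 3 = i -> regs s 4 = j -> i < M -> j < N ->
    regs s 7 = suff_best predT i j ->
    regs s 8 = addp (dist i j) (skip_best (infix (nseq K a)) i j) ->
    regs s 11 = suff_best (prefix (nseq K a)) i j ->
  vc w store (filled i j) s.
Proof.
move=> [[r0 r1 r2] _ _ _ _] fi r3 r4 iM jN r7 r8 r11.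
have addr_lt := address_lt (ltnW iM) (ltnW jN).
have := suff_best_infix i j; rewrite -r8 -r11 maxnC maxnE => sbi.
have le_M := suff_best_le (infix (nseq K a)) i j.
rewrite /= r3 r4 r1 r7 -sbi addn1; conj=> //; try lia.
move=> i' j' iM' jN' cond; rewrite /=.
(* An address determines its cell, since columns are smaller than [N.+1]. *)
have [e|ne] := eqVneq (i' * N.+1 + j') (i * N.+1 + j).
  have jE : j' = j.
    by have /(congr1 (modn^~ N.+1)) := e; rewrite !modnMDl !modn_small // ltnS ltnW.
  have iE : i' = i by move: e; rewrite jE => /addIn /eqP; rewrite eqn_pmul2r // => /eqP.
  by rewrite jE iE.
apply: fi => //; move: cond; case: (j' == N) => //=; case: (boundary _ _) => //=.
case: (i < i') => //= /andP[/eqP ei]; rewrite ei eqxx leq_eqVlt => /orP[/eqP ej|//].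
by rewrite ei ej eqxx in ne.
Qed.

Lemma vc_cell i j s : dp_input s -> filled i j.+1 s ->
    regs s 3 = i -> regs s 4 = j -> i < M -> j < N ->
  vc w cell (filled i j) s.
Proof.
move=> di fi r3 r4 iM jN.
apply: (vc_seq (vc_cell_lcs di fi r3 r4 iM jN)) => s1 r7 ag1.
have di1 := dp_input_agree di ag1 isT; have fi1 := filled_agree fi ag1 isT.
rewrite -(ag1.1 3 isT) in r3; rewrite -(ag1.1 4 isT) in r4.
apply: (vc_seq (vc_cell_infix di1 fi1 r3 r4 iM jN)) => s2 r8 ag2.
have di2 := dp_input_agree di1 ag2 isT; have fi2 := filled_agree fi1 ag2 isT.
rewrite -(ag2.1 3 isT) in r3; rewrite -(ag2.1 4 isT) in r4.
apply: (vc_seq (vc_cell_prefix di2 fi2 r3 r4 iM jN)) => s3 r11 ag3.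
have di3 := dp_input_agree di2 ag3 isT; have fi3 := filled_agree fi2 ag3 isT.
by apply: vc_store; rewrite // ?ag3.1 // ag2.1.
Qed.

End Cell.

(** * The whole table *)

(** Where A starts a run the row is tabulated in full; in any other row the column leaps left to the
    next run start of B. *)
Definition prev_column : cmd :=
  If (Read 5 (Reg 3) @= Reg 3)
     (Assign 4 (Reg 4 @- Const 1))
     (Assign 4 (Read 6 (Reg 4 @- Const 1))).

Definition row : cmd := While (Reg 4) (prev_column ;; cell).

Definition next_row : cmd := Assign 3 (Reg 3 @- Const 1) ;; Assign 4 (Reg 1).

Definition table : cmd := While (Reg 3) (next_row ;; row).

Definition program : cmd :=
  scan 0 ;; scan 1 ;; Assign 3 (Reg 0) ;; table ;; Assign 0 (Read 11 (Const 0)).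

Section Table.
Variables (w a K : nat) (A B : seq nat).
Local Notation M := (size A).
Local Notation N := (size B).
Hypotheses (K_gt0 : 0 < K) (w_big : 4 * (M.+1 * N.+1) <= 2 ^ w).

Let w_gt0 : 0 < w := word_size_gt0 K_gt0 w_big.

Definition prev i j := if run_start 0 A i then j else start_of 0 B j.

(** The number of cells still to be visited in row [i] left of column [j]: the potential of the row
    loop. *)
Definition columns i j := if run_start 0 A i then j else nstarts 0 B j.

Lemma columns_prev i j : j < N -> columns i j.+1 = (columns i (prev i j)).+1.
Proof. by rewrite /columns /prev; case: ifP => // _ /nstarts_start_of. Qed.

Lemma prev_le i j : prev i j <= j.
Proof. by rewrite /prev; case: ifP => // _; apply: start_of_le. Qed.

(** The columns leaped over are not run starts, so [filled] demands nothing of them in this row. *)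
Lemma filled_prev i j s : j < N -> filled a K A B i j.+1 s ->
  filled a K A B i (prev i j).+1 s.
Proof.
move=> jN fi i' j' iM' jN' cond; apply: fi => //.
move: cond; case: (j' == N) => //=; case bd: (boundary _ _ _ _) => //=.
case: (i < i') => //= /andP[/eqP ei]; rewrite ei eqxx /= in bd *.
move: bd; rewrite /prev /boundary; case: ifP => //= _ bd lt_j'.
rewrite ltnNge; apply: contraTN bd => le_j'.
by apply: (start_of_gap jN); rewrite lt_j'.
Qed.

Lemma vc_prev_column i j s : dp_input a K A B s ->
    regs s 3 = i -> regs s 4 = j.+1 -> i < M -> j < N ->
  vc w prev_column (fun s' => regs s' 4 = prev i j) s.
Proof.
move=> [_ _ _ [_ SA _] [_ SB _]] r3 r4 iM jN.
rewrite /= r3 r4 subn1 SA // SB // start_of_id // /prev.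
by case: ifP => _; conj=> // _; conj=> //; lia.
Qed.

Let cc := cost (prev_column ;; cell) + 2.

Lemma wp_row i s : dp_input a K A B s -> i < M -> regs s 3 = i ->
    regs s 4 = N -> filled a K A B i N s ->
  wp w row s (columns i N * cc + 2) (filled a K A B i 0).
Proof.
move=> di iM r3 r4 fi.
have := @wp_while w w_gt0 (fun n s => exists2 j, n = columns i j * cc &
  [/\ j <= N, regs s 4 = j & filled a K A B i j s]) (Reg 4) (prev_column ;; cell) s.
apply; last by exists N.
move=> n s1 ag1 [j -> [jN r41 fi1]]; split=> //=; rewrite r41.
  by move=> j0; rewrite j0 in fi1.
case: j jN r41 fi1 => // j jN r41 fi1 _; exists (cost (prev_column ;; cell)).
have di1 := dp_input_agree di ag1 isT.
have r31 : regs s1 3 = i by rewrite ag1.1.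
have step : vc w (prev_column ;; cell)
    (fun s' => regs s' 4 = prev i j /\ filled a K A B i (prev i j) s') s1.
  apply: (vc_seq (vc_prev_column di1 r31 r41 iM jN)) => s2 r42 ag2.
  have di2 := dp_input_agree di1 ag2 isT.
  have fi2 := filled_prev jN (filled_agree fi1 ag2 isT).
  have r32 : regs s2 3 = i by rewrite ag2.1.
  have lt_N : prev i j < N by apply: leq_ltn_trans (prev_le _ _) jN.
  apply: (vc_cut (vc_cell K_gt0 w_big di2 fi2 r32 r42 iM lt_N)) => s3 fi3 ag3.
  by rewrite ag3.1.
apply: (wp_frame (wp_vc w_gt0 _ step)) => // s2 [r42 fi2] _.
exists (columns i (prev i j) * cc).
  by rewrite columns_prev // mulSn /cc; lia.
by exists (prev i j); split=> //; apply: leq_trans (prev_le _ _) (ltnW jN).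
Qed.

(** The 10 pays for [next_row] (6), the final test of the row loop (2) and the test of the table
    loop (2). *)
Let row_cost i := columns i N * cc + 10.

Lemma wp_table s : dp_input a K A B s -> regs s 3 = M ->
    (forall x, mem s 10 x = 0) -> (forall x, mem s 11 x = 0) ->
  wp w table s (\sum_(i < M) row_cost i + 2) (filled a K A B 0 0).
Proof.
move=> di r3 m10 m11.
have := @wp_while w w_gt0 (fun n s => exists2 i, n = \sum_(k < i) row_cost k &
  [/\ i <= M, regs s 3 = i & filled a K A B i 0 s]) (Reg 3) (next_row ;; row) s.
apply; last first.
  (* Zeroed memory is already correct in the last row and column, where one suffix is empty. *)
  exists M => //; split=> // i j iM jN cond; rewrite m10 m11.
  suff z P : suff_best A B P i j = 0 by rewrite !z.
  apply/eqP; rewrite -leqn0 /suff_best; case/orP: cond => [/eqP->|].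
    by apply: best_le => Z _ _; rewrite drop_size subseq0 => /eqP->.
  case/andP=> _; rewrite ltnNge iM /= andbT => /eqP->.
  by apply: best_le => Z _; rewrite drop_size subseq0 => /eqP->.
move=> n s1 ag1 [i -> [iM r31 fi1]]; split=> //=; rewrite r31.
  by move=> i0; rewrite i0 in fi1.
case: i iM r31 fi1 => // i iM r31 fi1 _.
exists (cost next_row + (columns i N * cc + 2)).
have di1 := dp_input_agree di ag1 isT.
have step : vc w next_row (fun s' => regs s' 3 = i /\ regs s' 4 = N) s1.
  have [[_ r1 _] _ _ _ _] := di1.
  by rewrite /= r31 r1 subn1; conj=> //; lia.
apply: wp_seq; apply: (wp_frame (wp_vc w_gt0 _ step)) => // s2 [r32 r42] ag2.
have di2 := dp_input_agree di1 ag2 isT.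
(* Row [i] contributes only its cell in the last column, which [filled] includes already. *)
have fi2 : filled a K A B i N s2.
  move=> i' j' iM' jN' cond; apply: (filled_agree fi1 ag2 isT) => //.
  move: cond; case: eqP => //= ne; case: (boundary _ _ _ _) => //=; rewrite andbT.
  by case/orP => [|/andP[_ Nj]]; lia.
apply: (wp_frame (wp_row di2 iM r32 r42 fi2)) => // s3 fi3 ag3.
exists (\sum_(k < i) row_cost k).
  by rewrite big_ord_recr /= /row_cost; lia.
by exists i => //; split=> //; [apply: ltnW | rewrite ag3.1].
Qed.

End Table.

(** * Correctness and running time of the whole program *)

Lemma wp_program w a K (A B : seq nat) s :
    0 < K -> 0 < size A -> 0 < size B ->
    4 * ((size A).+1 * (size B).+1) <= 2 ^ w ->
    regs s 0 = size A -> regs s 1 = size B -> regs s 2 = K ->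
    (forall i, mem s 0 i = nth 0 A i) -> (forall j, mem s 1 j = nth 0 B j) ->
    mem s 2 0 = a ->
    (forall x, mem s 10 x = 0) -> (forall x, mem s 11 x = 0) ->
  wp w program s (1000 * (size (rle A) * size B + size (rle B) * size A))
    (fun s' => output s' = best (infix (nseq K a)) A B).
Proof.
move=> K_gt0 A_gt0 B_gt0 w_big r0 r1 r2 m0 m1 m2 m10 m11.
have [wA wB] : size A + 2 < 2 ^ w /\ size B + 2 < 2 ^ w.
  by split; move: w_big; rewrite ?[_ * (size B).+1]mulnS ?[(size A).+1 * _]mulSn; lia.
have w_gt0 := word_size_gt0 K_gt0 w_big.
pose T0 := 100 * (size A).+1; pose T1 := 100 * (size B).+1.
pose T2 := \sum_(i < size A) (columns A B i (size B) * (cost (prev_column ;; cell) + 2) + 10).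
apply: (@wp_leq _ _ _ (T0 + (T1 + (2 + ((T2 + 2) + 3))))).
  apply: wp_seq; apply: (wp_frame (@wp_scan w a K A K_gt0 wA 0 s _ _)) => // s1 scA ag1.
  apply: wp_seq; apply: (wp_frame (@wp_scan w a K B K_gt0 wB 1 s1 _ _)) => //.
    by split; rewrite ?ag1.1 ?ag1.2.
  move=> s2 scB ag2.
  have di : dp_input a K A B s2.
    split=> //; rewrite ?ag2.1 ?ag2.2 ?ag1.1 ?ag1.2 //.
    by rewrite /scanned !ag2.2.
  apply: wp_seq; apply: (wp_frame (@wp_vc w w_gt0 (Assign 3 (Reg 0)) s2
    (fun s' => regs s' 3 = size A) isT _)).
    by have [[r02 _ _] _ _ _ _] := di; split.
  move=> s3 r33 ag3; have di3 := dp_input_agree di ag3 isT.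
  apply: wp_seq; apply: (wp_frame (wp_table K_gt0 w_big di3 r33 _ _));
    try by move=> x; rewrite ag3.2 // ag2.2 // ag1.2.
  move=> s4 fi _; apply: (wp_vc w_gt0 (p := Assign 0 (Read 11 (Const 0)))) => //=; split.
    by lia.
  have [|_] := fi 0 0 isT isT; first by rewrite /boundary orbT.
  by rewrite /output /= /suff_best !drop0.
(* Full rows, one per run of A, visit N columns each; every other row visits one column per run of
   B. *)
have T2_le : T2 <= 266 * (size (rle A) * size B + size (rle B) * size A) + 10 * size A.
  rewrite -!(nstarts_size 0) mulnDr /T2.
  apply: (@leq_trans (\sum_(i < size A)
      (266 * (run_start 0 A i * size B) + 266 * nstarts 0 B (size B) + 10))).
    apply: leq_sum => i _; change (cost _ + 2) with 266; rewrite /columns.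
    by case: ifP => _; lia.
  have -> : 266 * (nstarts 0 A (size A) * size B) =
      \sum_(i < size A) 266 * (run_start 0 A i * size B).
    by rewrite /nstarts big_distrl big_distrr.
  by rewrite big_split big_split /= !sum_nat_const card_ord; lia.
(* Each string has at least one run, which absorbs the terms linear in the lengths. *)
have mA : 0 < size (rle A) by case: (A) A_gt0 => // x t _; have [l [r ->]] := rle_cons x t.
have mB : 0 < size (rle B) by case: (B) B_gt0 => // x t _; have [l [r ->]] := rle_cons x t.
have leA : size A <= size (rle B) * size A by rewrite leq_pmull.
have leB : size B <= size (rle A) * size B by rewrite leq_pmull.
by rewrite /T0 /T1; lia.
Qed.

(** * Transfer from letter codes to arbitrary alphabets, and the word size *)

Lemma size_rle_map (T T' : eqType) (f : T -> T') (s : seq T) :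
  injective f -> size (rle (map f s)) = size (rle s).
Proof.
move=> f_inj; elim: s => [|x [|y s] IH] //.
by rewrite size_rle_cons -IH !map_cons size_rle_cons (inj_eq f_inj).
Qed.

Lemma rle_constant (T : eqType) (x : T) s :
  size (rle (x :: s)) = 1 -> x :: s = nseq (size s).+1 x.
Proof.
elim: s x => // y s IH x; rewrite size_rle_cons.
have [<-|_] := eqVneq x y; first by move=> /(IH x) E; rewrite {1}E.
by have [l [r ->]] := rle_cons y s.
Qed.

Lemma infix_map (T T' : eqType) (f : T -> T') (s t : seq T) :
  infix s t -> infix (map f s) (map f t).
Proof. by move=> /infixP[p [q ->]]; rewrite !map_cat infix_infix. Qed.

(** Solutions are encoded by [f] for the upper bound and an optimal one is decoded by [g]. As [C] is
    nonempty, the value [0] occurs only without solutions. *)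
Lemma best_str_ic_lcs_length (T : eqType) (f : T -> nat) (g : nat -> T)
    (A B C : seq T) : cancel f g -> 0 < size C ->
  str_ic_lcs_length A B C (best (infix (map f C)) (map f A) (map f B)).
Proof.
move=> fK C_gt0; set l := best _ _ _.
have le_l Z : str_ic_cs A B C Z -> size Z <= l.
  case/and3P=> CZ ZA ZB; rewrite -(size_map f).
  by apply: best_ge; [apply: infix_map|apply: map_subseq|apply: map_subseq].
have mapK := mapK fK.
have [l0|/best_ex[Z [CZ ZA ZB sZ]]] := posnP l.
  right; split=> // Z; apply/negP => csZ; have := le_l Z csZ.
  by rewrite l0; have /and3P[/size_infix] := csZ; lia.
left; exists (map g Z); split; last by rewrite size_map.
split; last by move=> Z' /le_l; rewrite size_map sZ.
rewrite /str_ic_cs -(mapK C) -(mapK A) -(mapK B).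
by rewrite infix_map // !map_subseq.
Qed.

(** With D = M + N + S at least 2, one factor D^2 bounds 4 and the other the number of cells; D^4
    fits by the choice of [w]. *)
Lemma word_size_bound w M N S : 0 < M -> 0 < N -> 0 < S ->
  4 * up_log 2 (M + N + S) <= w -> 4 * (M.+1 * N.+1) <= 2 ^ w.
Proof.
move=> M_gt0 N_gt0 S_gt0 le_w; apply: leq_trans (_ : (M + N + S) ^ 4 <= _).
  have D_ge : M.+1 <= M + N + S /\ N.+1 <= M + N + S by lia.
  move: (M + N + S) D_ge => D [MD ND]; rewrite (expnD D 2 2) !mulnn.
  by rewrite leq_mul // ?leq_mul // (@leq_exp2r 2 D 2) //; lia.
apply: leq_trans (leq_pexp2l _ le_w) => //.
by rewrite mulnC expnM leq_exp2r // up_logP.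
Qed.

Theorem theorem10 :
  exists (p : cmd) (k c : nat),
  forall (Sigma : finType) (A B C : seq Sigma),
  let M := size A in
  let N := size B in
  let m := size (rle A) in
  let n := size (rle B) in
  0 < size C <= minn M N ->
  size (rle C) = 1 ->
  forall w : nat, k * up_log 2 (M + N + #|Sigma|) <= w ->
  exists (t : nat) (s : state),
    [/\ exec w p (input A B C) t s,
        t <= c * (m * N + n * M)
      & str_ic_lcs_length A B C (output s)].
Proof.
exists program, 4, 1000 => Sigma A B [//|x C] /= CM rleC w w_ge.
have [C_gt0 A_gt0 B_gt0] : [/\ 0 < size (x :: C), 0 < size A & 0 < size B].
  by move: CM; rewrite leq_min /= => /andP[]; split=> //; lia.
pose f (y : Sigma) := nat_of_ord (enum_rank y).
have fK : cancel f (nth x (enum Sigma)) by move=> y; apply: nth_enum_rank.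
have w_big : 4 * ((size (codes A)).+1 * (size (codes B)).+1) <= 2 ^ w.
  rewrite !size_map; apply: word_size_bound w_ge => //.
  by apply/card_gt0P; exists x.
have [t [s [ex le_t out]]] : wp w program (input A B (x :: C))
    (1000 * (size (rle (codes A)) * size (codes B) +
             size (rle (codes B)) * size (codes A)))
    (fun s => output s = best (infix (nseq (size C).+1 (f x))) (codes A) (codes B)).
  by apply: wp_program => //=; rewrite ?size_map // => i; rewrite nth_nil.
exists t, s; split=> //.
  by move: le_t; rewrite !size_map !(size_rle_map _ (can_inj fK)).
(* Having a single run, the pattern is a power of its first letter. *)
rewrite out -map_nseq -rle_constant //.
exact: best_str_ic_lcs_length fK C_gt0.
Qed.
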